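(* Let $f=f_1\circ\cdots\circ f_m$ be a composition of generalized Hénon maps as described in the context, and let $\mathcal G^+$ be the associated holomorphic foliation of $U^+$. Then the global leaves of $\mathcal G^+$ are the super-stable manifolds of $f$: for every $\zeta\in U^+$, the global leaf of $\mathcal G^+$ through $\zeta$ equals the set of points $\zeta'\in U^+$ for which $\mathrm{dist}(f^n\zeta,f^n\zeta')$ tends to $0$ super-exponentially as $n\to+\infty$, i.e. $\lim_{n\to+\infty}\frac1n\log\mathrm{dist}(f^n\zeta,f^n\zeta')=-\infty$.
   Context: Maps: $f=f_1\circ\cdots\circ f_m:\mathbf C^2\to\mathbf C^2$, $m\ge1$, where $f_j(x,y)=(y,p_j(y)-a_jx)$, $a_j\in\mathbf C\setminus\{0\}$, $p_j$ is a polynomial with $p_j(y)=y^{d_j}+O(y^{d_j-2})$, $d_j\ge2$; $d=d_1\cdots d_m$. $U^+$ is the set of points of $\mathbf C^2$ with unbounded forward orbit. For $R$ sufficiently large, $V^+=\{|y|\ge|x|,\ |y|\ge R\}$ satisfies $fV^+\subset V^+$ and $U^+=\bigcup_{n\ge0}f^{-n}V^+$. With $\pi_2(x,y)=y$, the function $\varphi^+(x,y)=\lim_{n\to\infty}(\pi_2\circ f^n(x,y))^{1/d^n}$, where the roots are chosen so that $\varphi^+(x,y)=y+o(1)$ on $V^+$, is holomorphic on $V^+$ and satisfies $\varphi^+\circ f=(\varphi^+)^d$. The foliation $\mathcal G^+$ of $U^+$ is the $f$-invariant holomorphic foliation on whose leaves $\varphi^+$ is locally constant in $V^+$: for $|\xi|>R$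 the set $\Delta_\xi=\{p\in V^+:\varphi^+(p)=\xi\}$ is a complex disk with $f\Delta_\xi\subset\Delta_{\xi^d}$, the global leaf containing it is $L_\xi=\bigcup_{n\ge1}f^{-n}\Delta_{\xi^{d^n}}$, and every global leaf is of the form $f^{-n}L_\xi$. Equivalently, two points $p,q\in U^+$ are in the same global leaf iff for some $n\ge0$ one has $f^np,f^nq\in V^+$ and $\varphi^+(f^np)=\varphi^+(f^nq)$. *)

(* Defs.v *)
From HB Require Import structures.
From mathcomp Require Import all_boot all_order all_algebra.
From mathcomp Require Import complex.
From mathcomp Require Import all_classical all_reals all_analysis.

Set Implicit Arguments.
Unset Strict Implicit.
Unset Printing Implicit Defensive.

Import Order.TTheory GRing.Theory Num.Theory.
Import numFieldNormedType.Exports.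

Local Open Scope classical_set_scope.
Local Open Scope ring_scope.

Section HenonFoliation.
Variable R : realType.

(* MathComp-Analysis puts the usual topology of R[i] on its alias R[i]^o. *)
Notation C := (R[i]^o).
Notation C2 := (C * C)%type.

(* The real-valued modulus: the norm `|z| of R[i] is itself an element of R[i]. *)
Definition cabs (z : C) : R := ComplexField.Normc.normc z.

Definition norm2 (z : C2) : R := Num.sqrt (cabs z.1 ^+ 2 + cabs z.2 ^+ 2).

Definition dist (z w : C2) : R := norm2 (z - w).

(* p(y) = y^d + O(y^(d-2)): as [size] is the degree plus one, the second
   condition says that p - y^d has degree at most d - 2. *)
Definition henon_poly (d : nat) (p : {poly R[i]}) : Prop :=
  (2 <= d)%N /\ (size (p - 'X^d)%R <= d.-1)%N.

Definition gen_henon (p : {poly R[i]}) (a : C) (z : C2) : C2 :=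
  (z.2, p.[z.2] - a * z.1).

(* f_0 \o f_1 \o ... \o f_(m-1), so that f_(m-1) is applied first. *)
Definition henon_comp (m : nat) (p : 'I_m -> {poly R[i]}) (a : 'I_m -> C) :
    C2 -> C2 :=
  \big[(fun g h : C2 -> C2 => g \o h)/id]_(j < m) gen_henon (p j) (a j).

Definition Uplus (f : C2 -> C2) : set C2 :=
  [set z | ~ exists M : R, forall n : nat, norm2 (iter n f z) <= M].

Definition Vplus (r : R) : set C2 :=
  [set z | cabs z.1 <= cabs z.2 /\ r <= cabs z.2].

(* phi is the function phi^+(x, y) = lim_n (pi_2 (f^n (x, y)))^(1/d^n) on V^+.
   The roots are continuous branches rho_n on V^+, so each rho_n is determined
   up to a constant d^n-th root of unity, and the normalization of the limit at
   infinity then determines phi on V^+.  The normalization is stated as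
   phi = y (1 + o(1)), uniformly as |y| -> +oo in V^+.  This follows from
   phi = y + o(1) and already fixes the roots, whereas y + o(1) itself fails on
   the whole of V^+ when the map applied first is quadratic: for
   f(x, y) = (y, y^2 + c - a x) one has phi = y - a x / (2 y) + o(1).
   Holomorphy of phi and phi \o f = phi^d on V^+ are consequences. *)
Definition is_phi_plus (f : C2 -> C2) (d : nat) (r : R) (phi : C2 -> C) : Prop :=
  (exists rho : nat -> C2 -> C,
    [/\ forall n : nat, {within Vplus r, continuous (rho n)},
        forall (n : nat) (z : C2), Vplus r z ->
          rho n z ^+ (d ^ n) = (iter n f z).2
      & forall z : C2, Vplus r z -> rho n z @[n --> \oo] --> phi z])
  /\ (forall e : R, 0 < e -> exists M : R, forall z : C2,
        Vplus r z -> M <= cabs z.2 -> cabs (phi z - z.2) <= e * cabs z.2).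

Definition global_leaf (f : C2 -> C2) (r : R) (phi : C2 -> C) (z : C2) :
    set C2 :=
  [set w | Uplus f w /\ exists n : nat,
     [/\ Vplus r (iter n f z), Vplus r (iter n f w)
       & phi (iter n f z) = phi (iter n f w)]].

(* [lne] is the extended logarithm, with lne 0 = -oo; hence z belongs to its
   own super-stable manifold. *)
Definition superstable (f : C2 -> C2) (z : C2) : set C2 :=
  [set w | Uplus f w /\
     ((n%:R^-1)%:E * lne (dist (iter n f z) (iter n f w))%:E)%E
       @[n --> \oo] --> -oo%E].

End HenonFoliation.

(* Main.v *)
(* On V^+ one has phi (f z) = phi z ^ D: the branches rho (n+1) ^ D and
   rho n \o f differ by a root of unity, which is constant because V^+ is
   connected, and the normalization at infinity shows that the limit constant
   is 1.

   Let z, w be in V^+ and let y_k, y'_k be the second coordinates of their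
   orbits under the successive Henon factors.  If phi z = phi w then
   y'_k / y_k --> 1, as phi ~ y.  The relative differences
   e_k = |y'_k - y_k| / |y_k| satisfy
   e_k <= (2/3) e_(k+1) + K / (|y_(k-1)| |y_k|), since y |-> y^d expands; hence
   e_k <= 3 K / (|y_(k-1)| |y_k|), and |y_k| grows faster than any geometric
   sequence.  Conversely, if the distance of the orbits stays bounded, the
   ratios t_n = phi (f^n w) / phi (f^n z) tend to 1 and t_(n+1) = t_n ^ D; as
   1 is a repelling fixed point of t |-> t ^ D, some t_n equals 1. *)
Require Import Defs.
From HB Require Import structures.
From mathcomp Require Import all_boot all_order all_algebra.
From mathcomp Require Import complex zify ring lra.
From mathcomp Require Import all_classical all_reals all_analysis.

Set Implicit Arguments.
Unset Strict Implicit.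
Unset Printing Implicit Defensive.

Import Order.TTheory GRing.Theory Num.Theory.
Import numFieldNormedType.Exports.

Local Open Scope classical_set_scope.
Local Open Scope ring_scope.

(** * The real-valued modulus and the norm of C^2 *)

Section ComplexModulus.
Variable R : realType.
Implicit Types x y z u v : R[i].

Lemma cabsE z : `|z| = (cabs z)%:C%C.
Proof. by case: z => a b; rewrite normc_def. Qed.

Lemma cabs_ge0 z : 0 <= cabs z.
Proof. by case: z => a b; apply: sqrtr_ge0. Qed.

Lemma cabsM x y : cabs (x * y) = cabs x * cabs y.
Proof. exact: ComplexField.Normc.normcM. Qed.

Lemma cabsV x : cabs x^-1 = (cabs x)^-1.
Proof. exact: ComplexField.Normc.normcV. Qed.

Lemma cabs0 : cabs (0 : R[i]) = 0.
Proof. exact: ComplexField.Normc.normc0. Qed.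

Lemma cabs1 : cabs (1 : R[i]) = 1.
Proof. exact: ComplexField.Normc.normc1. Qed.

Lemma cabsX x n : cabs (x ^+ n) = cabs x ^+ n.
Proof. by elim: n => [|n IHn]; rewrite ?cabs1 // !exprS cabsM IHn. Qed.

Lemma cabsN x : cabs (- x) = cabs x.
Proof. by case: x => a b; rewrite /cabs /= !sqrrN. Qed.

Lemma cabs_eq0 x : (cabs x == 0) = (x == 0).
Proof.
apply/eqP/eqP => [|->]; first exact: ComplexField.Normc.eq0_normc.
exact: cabs0.
Qed.

Lemma cabs_gt0 x : (0 < cabs x) = (x != 0).
Proof. by rewrite lt_neqAle cabs_ge0 andbT eq_sym cabs_eq0. Qed.

Lemma cabsD x y : cabs (x + y) <= cabs x + cabs y.
Proof. by rewrite -lecR rmorphD /= -!cabsE ler_normD. Qed.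

Lemma cabsB x y : cabs (x - y) <= cabs x + cabs y.
Proof. by rewrite (le_trans (cabsD _ _)) // cabsN. Qed.

Lemma cabsC x y : cabs (x - y) = cabs (y - x).
Proof. by rewrite -cabsN opprB. Qed.

Lemma cabs_subl x y : cabs x <= cabs (x - y) + cabs y.
Proof. by rewrite -{1}(subrK y x) cabsD. Qed.

Lemma cabs_subr x y : cabs y <= cabs (x - y) + cabs x.
Proof. by rewrite cabsC cabs_subl. Qed.

Lemma cabs_real (t : R) : cabs (t%:C%C : R[i]) = `|t|.
Proof. by rewrite /cabs /= expr0n /= addr0 sqrtr_sqr. Qed.

Lemma cabs_nat n : cabs (n%:R : R[i]) = n%:R.
Proof. by rewrite -(rmorph_nat (real_complex R)) cabs_real normr_nat. Qed.

Lemma cabs_sum n (F : 'I_n -> R[i]) :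
  cabs (\sum_(i < n) F i) <= \sum_(i < n) cabs (F i).
Proof.
elim/big_ind2: _ => [|x a y b xa yb|//]; first by rewrite cabs0.
by rewrite (le_trans (cabsD _ _)) // lerD.
Qed.

(** In the factorization of u^n - v^n each of the n summands has modulus at most M^(n-1), which M >=
    1 allows to round up to M^n. *)
Lemma cabs_expB_le (M : R) u v n : 1 <= M -> cabs u <= M -> cabs v <= M ->
  cabs (u ^+ n - v ^+ n) <= n%:R * M ^+ n * cabs (u - v).
Proof.
move=> M1 uM vM; rewrite subrXX cabsM mulrC ler_wpM2r ?cabs_ge0 //.
apply: le_trans (cabs_sum _) _.
rewrite mulr_natl -[n in X in _ *+ X]card_ord -sumr_const.
apply: ler_sum => i _.
rewrite cabsM !cabsX.
have M0 : 0 <= M by lra.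
rewrite (@le_trans _ _ (M ^+ (n.-1 - i) * M ^+ i)) //.
  by rewrite ler_pM ?exprn_ge0 ?cabs_ge0 ?lerXn2r ?nnegrE ?cabs_ge0.
rewrite -exprD ler_weXn2l //; have := ltn_ord i; lia.
Qed.

Lemma norm2_le (z : R[i] * R[i]) : norm2 z <= cabs z.1 + cabs z.2.
Proof.
have x0 := cabs_ge0 z.1; have y0 := cabs_ge0 z.2.
rewrite -[leRHS]ger0_norm ?addr_ge0 // -sqrtr_sqr ler_wsqrtr //.
by rewrite sqrrD; have := mulr_ge0 x0 y0; lra.
Qed.

Lemma norm2_ge (z : R[i] * R[i]) : cabs z.1 <= norm2 z /\ cabs z.2 <= norm2 z.
Proof.
have x0 := cabs_ge0 z.1; have y0 := cabs_ge0 z.2.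
by split; rewrite -[leLHS]ger0_norm // -sqrtr_sqr ler_wsqrtr //
  ?lerDl ?lerDr sqr_ge0.
Qed.

End ComplexModulus.

(** * Limits and asymptotic equivalence of complex sequences *)

Section Asymptotics.
Variable R : realType.
Implicit Types (u v w : nat -> R[i]).

Lemma cvg_cabsP (u : nat -> R[i]^o) (l : R[i]^o) :
  (u n @[n --> \oo] --> l) <->
  (forall e : R, 0 < e -> \forall n \near \oo, cabs (u n - l) <= e).
Proof.
split=> [/cvgrPdist_le ul e e0|ul].
  have e0' : 0 < e%:C%C by rewrite ltcR.
  by near do rewrite -lecR -cabsE -normrN opprB; apply: ul.
(* The order of [R[i]] compares only numbers with equal imaginary parts, so a positive radius is a
   positive real. *)
apply/cvgrPdist_le => -[e e']; rewrite ltcE /= => /andP[/eqP ->{e'} e0].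
by near do rewrite -normrN opprB cabsE lecR; apply: ul.
Unshelve. all: by end_near. Qed.

Definition asymp u v : Prop :=
  (u n / v n : R[i]^o) @[n --> \oo] --> (1 : R[i]^o).

(** As x / 0 = 0, a zero of either sequence makes the quotient 0, which is at distance 1 from the
    limit. *)
Lemma asymp_neq0 u v :
  asymp u v -> \forall n \near \oo, u n != 0 /\ v n != 0.
Proof.
move=> /cvg_cabsP/(_ (1/2)) uv; near=> n.
have : cabs (u n / v n - 1) <= 1/2 by near: n; apply: uv; lra.
apply: contraPP => /not_andP H.
suff -> : u n / v n = 0 by rewrite add0r cabsN cabs1; lra.
by case: H => /negP; rewrite negbK => /eqP ->; rewrite ?mul0r ?invr0 ?mulr0.
Unshelve. all: by end_near. Qed.

Lemma asympP u v : asymp u v <->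
  forall e : R, 0 < e ->
    \forall n \near \oo, v n != 0 /\ cabs (u n - v n) <= e * cabs (v n).
Proof.
split=> [uv e e0|uv].
  move/cvg_cabsP: (uv) => /(_ e e0) H; move/asymp_neq0: uv => H0.
  near=> n; have [_ vn0] : u n != 0 /\ v n != 0 by near: n.
  split=> //; have -> : u n - v n = (u n / v n - 1) * v n by field.
  by rewrite cabsM ler_wpM2r ?cabs_ge0 //; near: n.
apply/cvg_cabsP => e e0; near=> n.
have [v0 uvn] : v n != 0 /\ cabs (u n - v n) <= e * cabs (v n).
  by near: n; apply: uv.
have -> : u n / v n - 1 = (u n - v n) / v n by field.
by rewrite cabsM cabsV ler_pdivrMr ?cabs_gt0.
Unshelve. all: by end_near. Qed.

Lemma asymp_sym u v : asymp u v -> asymp v u.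
Proof.
move=> uv; rewrite /asymp -[X in _ --> X]invr1.
under eq_fun do rewrite -invf_div.
by apply: cvgV => //; rewrite oner_eq0.
Qed.

Lemma asymp_trans u v w : asymp u v -> asymp v w -> asymp u w.
Proof.
move=> uv vw; rewrite /asymp -[X in _ --> X]mulr1.
apply: cvg_trans (cvgM uv vw); apply: near_eq_cvg.
move/asymp_neq0: uv => H0; near=> n.
have [_ vn0] : u n != 0 /\ v n != 0 by near: n.
by rewrite /= /GRing.mul_fun /= mulrA divfK.
Unshelve. all: by end_near. Qed.

Lemma cvg_exprn (T : Type) (F : set_system T) (FF : Filter F)
    (h : T -> R[i]^o) (l : R[i]^o) d :
  (h x @[x --> F] --> l) ->
  (h x ^+ d : R[i]^o) @[x --> F] --> (l ^+ d : R[i]^o).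
Proof.
move=> hl; elim: d => [|d IHd].
  by under eq_fun do rewrite expr0; apply: cvg_cst.
under eq_fun do rewrite exprS.
rewrite exprS; exact: (@cvgM _ _ _ FF _ _ _ _ hl IHd).
Qed.

Lemma asympX u v d :
  asymp u v -> asymp (fun n => u n ^+ d) (fun n => v n ^+ d).
Proof.
move=> uv; rewrite /asymp -[X in _ --> X](expr1n _ d).
under eq_fun do rewrite -expr_div_n.
exact: cvg_exprn.
Qed.

End Asymptotics.

(** * Estimates for a single Hénon map near infinity *)

Section HenonSteps.
Variable R : realType.
Implicit Types (q p : {poly R[i]}) (x y a : R[i]) (z : R[i] * R[i]).

Lemma horner_cabs_le q n : (size q <= n.+1)%N ->
  exists2 K : R, 0 <= K &
    forall y, 1 <= cabs y -> cabs q.[y] <= K * cabs y ^+ n.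
Proof.
move=> qn; exists (\sum_(i < size q) cabs q`_i).
  by apply: sumr_ge0 => i _; rewrite cabs_ge0.
move=> y y1; rewrite horner_coef mulr_suml; apply: le_trans (cabs_sum _) _.
apply: ler_sum => i _; rewrite cabsM cabsX ler_wpM2l ?cabs_ge0 //.
by rewrite ler_weXn2l // -ltnS (leq_trans (ltn_ord i)).
Qed.

Lemma horner_cabs_lip q n : (size q <= n.+1)%N ->
  exists2 K : R, 0 <= K &
    forall y y', 1 <= cabs y -> cabs y' <= 2 * cabs y ->
      cabs (q.[y] - q.[y']) <= K * cabs y ^+ n * cabs (y - y').
Proof.
move=> qn; exists (\sum_(i < size q) cabs q`_i * (i%:R * 2 ^+ i)).
  by apply: sumr_ge0 => i _; rewrite !mulr_ge0 ?cabs_ge0 ?exprn_ge0.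
move=> y y' y1 y'y; rewrite !horner_coef -sumrB !mulr_suml.
apply: le_trans (cabs_sum _) _; apply: ler_sum => i _.
rewrite -mulrBr cabsM -!mulrA ler_wpM2l ?cabs_ge0 //.
(* Both arguments lie in the disk of radius 2 |y|, which serves as the bound M for each monomial. *)
have y2 : 1 <= 2 * cabs y by lra.
apply: le_trans (cabs_expB_le i y2 _ y'y) _; first by lra.
rewrite exprMn !mulrA ler_wpM2r ?cabs_ge0 // ler_wpM2l ?mulr_ge0 ?exprn_ge0 //.
by rewrite ler_weXn2l // -ltnS (leq_trans (ltn_ord i)).
Qed.

(** The third clause says that the new second coordinate is y^d up to a relative error K / |y|. The
    fourth is a Lipschitz bound on the lower-order part p - y^d, one order below the expansion d
    |y|^(d-1) of y^d. *)
Definition henon_bound (K : R) (d : nat) p a : Prop :=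
  [/\ 0 <= K, cabs a <= K,
      forall x y, 1 <= cabs y -> cabs x <= cabs y ->
        cabs (p.[y] - a * x - y ^+ d) <= K * cabs y ^+ d.-1
    & forall y y', 1 <= cabs y -> cabs y' <= 2 * cabs y ->
        cabs ((p.[y] - y ^+ d) - (p.[y'] - y' ^+ d))
          <= K * cabs y ^+ d.-2 * cabs (y - y')].

Lemma henon_bound_le K K' d p a :
  K <= K' -> henon_bound K d p a -> henon_bound K' d p a.
Proof.
move=> KK' [K0 aK gK lK]; split.
- exact: le_trans KK'.
- exact: le_trans KK'.
- move=> x y y1 xy; apply: le_trans (gK _ _ y1 xy) _.
  by rewrite ler_wpM2r ?exprn_ge0 ?cabs_ge0.
- move=> y y' y1 yy'; apply: le_trans (lK _ _ y1 yy') _.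
  by rewrite -!mulrA ler_wpM2r // mulr_ge0 ?exprn_ge0 ?cabs_ge0.
Qed.

Lemma henon_boundP d p a : henon_poly d p -> exists K, henon_bound K d p a.
Proof.
move=> [d2 sp]; case: d d2 sp => [|[|d]] //= _ sp.
have [K1 K10 K1P] := horner_cabs_le sp.
have [K2 K20 K2P] := horner_cabs_lip sp.
have a0 := cabs_ge0 a.
exists (cabs a + K1 + K2); split => //=; try lra.
- move=> x y y1 xy.
  have -> : p.[y] - a * x - y ^+ d.+2 = (p - 'X^(d.+2)).[y] - a * x.
    by rewrite !hornerE; ring.
  apply: le_trans (cabsB _ _) _; rewrite cabsM.
  have Y1 : cabs y <= cabs y ^+ d.+1.
    by rewrite exprS ler_peMr ?exprn_ege1 //; lra.
  have Yd : cabs y ^+ d <= cabs y ^+ d.+1 by rewrite ler_weXn2l.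
  have := K1P y y1.
  have : cabs a * cabs x <= cabs a * cabs y ^+ d.+1.
    by rewrite ler_wpM2l //; lra.
  have : K1 * cabs y ^+ d <= K1 * cabs y ^+ d.+1 by rewrite ler_wpM2l.
  have : 0 <= K2 * cabs y ^+ d.+1 by rewrite mulr_ge0 ?exprn_ge0 ?cabs_ge0.
  lra.
- move=> y y' y1 yy'.
  have -> : p.[y] - y ^+ d.+2 - (p.[y'] - y' ^+ d.+2) =
      (p - 'X^(d.+2)).[y] - (p - 'X^(d.+2)).[y'] by rewrite !hornerE; ring.
  apply: le_trans (K2P _ _ y1 yy') _.
  rewrite -!mulrA ler_wpM2r ?mulr_ge0 ?exprn_ge0 ?cabs_ge0 //; lra.
Qed.

Lemma henon_bound_uniform m (d : 'I_m -> nat) (p : 'I_m -> {poly R[i]})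
    (a : 'I_m -> R[i]) :
  (forall j, henon_poly (d j) (p j)) ->
  exists2 K : R, 0 <= K & forall j, henon_bound K (d j) (p j) (a j).
Proof.
move=> hp; have /choice[B BP] := fun j => henon_boundP (a j) (hp j).
have B0 j : 0 <= B j by have [] := BP j.
exists (\sum_(j < m) B j); first exact: sumr_ge0.
move=> j; apply: henon_bound_le (BP j).
by rewrite (bigD1 j) //= lerDl sumr_ge0.
Qed.

(** For |y| >= 10 K + 10 the error K |y|^(d-1) is at most |y|^d / 10, and |y|^d >= 10 |y| as d >= 2.
    So the new second coordinate dominates the old one, which is the new first coordinate. *)
Lemma Vplus_step K d p a r z : (2 <= d)%N -> henon_bound K d p a ->
  10 * K + 10 <= r -> Vplus r z ->
  [/\ Vplus r (gen_henon p a z),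
      2 * cabs z.2 <= cabs (gen_henon p a z).2,
      9/10 * cabs z.2 ^+ d <= cabs (gen_henon p a z).2
    & cabs (gen_henon p a z).2 <= 11/10 * cabs z.2 ^+ d].
Proof.
case: d => [|[|d]] //= _ [K0 aK gK _] rK [] xy ry.
have y1 : 1 <= cabs z.2 by lra.
rewrite /Vplus /gen_henon /=; set w := _ - _.
have := gK _ _ y1 xy; rewrite -/w /= => wy.
have Y1 : 1 <= cabs z.2 ^+ d by rewrite exprn_ege1.
have wlow := cabs_subr w (z.2 ^+ d.+2); have whigh := cabs_subl w (z.2 ^+ d.+2).
move: wlow whigh wy; rewrite !cabsX !exprS.
move: (cabs _ ^+ d) Y1 => Y Y1; move: (cabs (w - _)) => e.
have y0 := cabs_ge0 z.2.
have : K * (cabs z.2 * Y) <= 1/10 * (cabs z.2 * (cabs z.2 * Y)).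
  by rewrite [leRHS]mulrA ler_wpM2r ?mulr_ge0 //; lra.
have : 10 * cabs z.2 <= cabs z.2 * (cabs z.2 * Y).
  rewrite mulrCA mulrA -[leLHS]mulr1 ler_pM ?mulr_ge0 //; try lra.
  by rewrite ler_wpM2r //; lra.
by split; try split; lra.
Qed.

(** The relative error is at most K / |y|, which tends to 0. *)
Lemma asymp_step K d p a (x y : nat -> R[i]) : (2 <= d)%N ->
  henon_bound K d p a ->
  (forall M : R, \forall n \near \oo, M <= cabs (y n)) ->
  (\forall n \near \oo, cabs (x n) <= cabs (y n)) ->
  asymp (fun n => p.[y n] - a * x n) (fun n => y n ^+ d).
Proof.
case: d => [|[|d]] //= _ [K0 aK gK _] yoo xy.
apply/asympP => e e0; near=> n.
have y1 : 1 <= cabs (y n) by near: n; apply: yoo.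
have yK : K / e <= cabs (y n) by near: n; apply: yoo.
split; first by rewrite expf_neq0 // -cabs_gt0; lra.
have xyn : cabs (x n) <= cabs (y n) by near: n.
apply: le_trans (gK _ _ y1 xyn) _.
rewrite cabsX [in leRHS]exprS mulrA ler_wpM2r ?exprn_ge0 ?cabs_ge0 //.
by rewrite mulrC -ler_pdivrMr.
Unshelve. all: by end_near. Qed.

End HenonSteps.

(** * Connectedness of V^+ *)

Section Connectedness.
Variable R : realType.
Notation C := (R[i]^o).
Notation C2 := (C * C)%type.
Notation Re := complex.Re.
Notation Im := complex.Im.

Lemma real_complex_continuous : continuous (fun t : R => t%:C%C : C).
Proof.
move=> t; apply/cvgrPdist_le => -[e e'].
rewrite ltcE /= => /andP[/eqP ->{e'} e0].
near=> s; rewrite -(rmorphB (real_complex R)) cabsE cabs_real lecR.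
by near: s; move: e e0; apply/cvgrPdist_le; exact: cvg_id.
Unshelve. all: by end_near. Qed.

Definition segmentC (u v : C2) (t : R) : C2 :=
  ((1 - t)%:C%C * u.1 + t%:C%C * v.1, (1 - t)%:C%C * u.2 + t%:C%C * v.2).

Lemma segmentC_continuous u v : continuous (segmentC u v).
Proof.
move=> t.
have c1 : (fun t : R => (1 - t)%:C%C : C) @ t --> ((1 - t)%:C%C : C).
  apply: continuous_comp; last exact: real_complex_continuous.
  by apply: cvgB; [exact: cvg_cst|exact: cvg_id].
have c2 := @real_complex_continuous t.
have cv (a b : C) : (fun t : R => (1 - t)%:C%C * a + t%:C%C * b : C) @ t -->
    ((1 - t)%:C%C * a + t%:C%C * b : C).
  have c1a := @cvgM _ _ _ (nbhs_filter t) _ _ _ _ c1 (cvg_cst (a : C)).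
  have c2b := @cvgM _ _ _ (nbhs_filter t) _ _ _ _
    (c2 : _ @ t --> _) (cvg_cst (b : C)).
  have H := cvgD (c1a _) (c2b _).
  exact: H.
exact: (cvg_pair (cv _ _) (cv _ _)).
Qed.

Lemma connected_component_segmentC (A : set C2) u v :
  (forall t, 0 <= t <= 1 -> A (segmentC u v t)) -> connected_component A u v.
Proof.
move=> uvA.
have S0 : segmentC u v 0 = u.
  by case: u {uvA} => a b; rewrite /segmentC subr0 !mul1r !mul0r !addr0.
have S1 : segmentC u v 1 = v.
  by case: v {uvA S0} => a b; rewrite /segmentC subrr !mul1r !mul0r !add0r.
apply: (@connected_component_max _ A (segmentC u v @` `[0, 1])).
- by exists 0; rewrite //= in_itv /= lexx ler01.
- by move=> _ [t + <-]; rewrite /= in_itv /=; exact: uvA.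
- apply: connected_continuous_connected; first exact: segment_connected.
  by apply: continuous_subspaceT; exact: segmentC_continuous.
- by exists 1; rewrite //= in_itv /= lexx ler01.
Qed.

Lemma normr_Re_le_cabs (z : R[i]) : `|Re z| <= cabs z.
Proof.
by case: z => a b; rewrite /cabs /= -sqrtr_sqr ler_wsqrtr // lerDl sqr_ge0.
Qed.

Lemma normr_Im_le_cabs (z : R[i]) : `|Im z| <= cabs z.
Proof.
by case: z => a b; rewrite /cabs /= -sqrtr_sqr ler_wsqrtr // lerDr sqr_ge0.
Qed.

(* A point is moved to the y-axis, then radially outwards into one of the
   half-planes where Re y or Im y is [>= r] or [<= - r]; cyclically ordered,
   each of these meets the next one. *)
Lemma Vplus_connected (r : R) : 0 < r -> connected (Vplus r : set C2).
Proof.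
move=> r0; set V : set C2 := Vplus r.
pose c (a b : R) : C2 := (0, (a +i* b)%C).
(* For L one of Re, -Re, Im, -Im, the set L >= r is convex and lies in |y| >= r, so its segments on
   the y-axis stay in V^+. *)
have half (L : R[i] -> R) (u v : C) :
    (forall t (x y : R[i]), 
       L (t%:C%C * x) = t * L x /\ L (x + y) = L x + L y) ->
    (forall y, L y <= cabs y) -> r <= L u -> r <= L v ->
    connected_component V (0, u) (0, v).
  move=> LL Lc ru rv; apply: connected_component_segmentC => t /andP[t0 t1].
  rewrite /segmentC; split; rewrite [_.1]/= [_.2]/=.
    by rewrite !mulr0 addr0 cabs0 cabs_ge0.
  apply: le_trans (Lc _).
  have [_ ->] := LL 0 ((1 - t)%:C%C * u) (t%:C%C * v).
  have [-> _] := LL (1 - t) u 0; have [-> _] := LL t v 0.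
  have := ler_wpM2l t0 rv; have : 0 <= 1 - t by lra.
  move=> /ler_wpM2l/(_ _ _ ru). lra.
have reP t (x y : R[i]) :
    Re (t%:C%C * x) = t * Re x /\ Re (x + y) = Re x + Re y.
  by case: x y => x1 x2 [y1 y2] /=; rewrite mul0r subr0.
have imP t (x y : R[i]) :
    Im (t%:C%C * x) = t * Im x /\ Im (x + y) = Im x + Im y.
  by case: x y => x1 x2 [y1 y2] /=; rewrite mul0r addr0.
have nP (L : R[i] -> R) :
    (forall t x y, L (t%:C%C * x) = t * L x /\ L (x + y) = L x + L y) ->
    forall t x y, - L (t%:C%C * x) = t * - L x /\ - L (x + y) = - L x + - L y.
  by move=> LL t x y; have [-> ->] := LL t x y; rewrite mulrN opprD.
have le_re (z : R[i]) := le_trans (ler_norm (Re z)) (normr_Re_le_cabs z).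
have le_im (z : R[i]) := le_trans (ler_norm (Im z)) (normr_Im_le_cabs z).
have le_reN (z : R[i]) : - Re z <= cabs z.
  by apply: le_trans (normr_Re_le_cabs z); rewrite lerNl lerNnormlW.
have le_imN (z : R[i]) : - Im z <= cabs z.
  by apply: le_trans (normr_Im_le_cabs z); rewrite lerNl lerNnormlW.
have corner (y : R[i]) : r <= `|Re y| \/ r <= `|Im y| ->
    connected_component V (0, y) (c r r).
  case=> [|]; rewrite ler_normr => /orP[] h.
  - by apply: (half _ _ _ reP le_re).
  - apply: (@connected_component_trans _ V (c (- r) r)).
      2: by apply: (half _ _ _ imP le_im).
    by apply: (half _ _ _ (nP _ reP) le_reN) => //=; rewrite opprK.
  - by apply: (half _ _ _ imP le_im).
  - apply: (@connected_component_trans _ V (c r (- r))).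
      2: by apply: (half _ _ _ reP le_re).
    by apply: (half _ _ _ (nP _ imP) le_imN) => //=; rewrite opprK.
suff VE z : V z -> connected_component V (c r r) z.
  have crr : V (c r r).
    split; last exact: (le_re (r +i* r)%C).
    by rewrite [(c r r).1]/= cabs0 cabs_ge0.
  rewrite (_ : V = connected_component V (c r r)).
    exact: component_connected.
  by apply/seteqP; split=> [z /VE //|]; apply: connected_component_sub.
case: z => x y -[/= xy ry]; apply: connected_component_sym.
have y0 : 0 < cabs y by lra.
apply: (@connected_component_trans _ _ (0, y)).
  apply: connected_component_segmentC => t /andP[t0 t1].
  rewrite /segmentC [_.1]/= [_.2]/= mulr0 addr0 -mulrDl -rmorphD subrK mul1r.
  split => //; rewrite [_.1]/= [_.2]/= cabsM cabs_real ger0_norm ?subr_ge0 //.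
  have := cabs_ge0 x; nra.
(* The factor 1 + r / |b|, with b a nonzero real or imaginary part of y, brings that part to modulus
   |b| + r. *)
have [s s1 sy] : exists2 s : R, 1 <= s &
    r <= `|Re (s%:C%C * y)| \/ r <= `|Im (s%:C%C * y)|.
  have big (b : R) : b != 0 -> r <= `|(1 + r / `|b|) * b|.
    move=> b0; rewrite normrM ger0_norm ?addr_ge0 ?divr_ge0 ?normr_ge0
      ?(ltW r0) //.
    by rewrite mulrDl mul1r divfK ?normr_eq0 // lerDr.
  have [re0|re0] := eqVneq (Re y) 0.
    have im0 : Im y != 0.
      apply: contraTneq y0 => im0.
      rewrite (_ : y = 0) ?cabs0 ?ltxx //; apply/eqP.
      by rewrite eq_complex re0 im0 eqxx.
    exists (1 + r / `|Im y|); first by rewrite lerDl divr_ge0 ?normr_ge0 ?ltW.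
    by right; have [-> _] := imP (1 + r / `|Im y|) y 0; apply: big.
  exists (1 + r / `|Re y|); first by rewrite lerDl divr_ge0 ?normr_ge0 ?ltW.
  by left; have [-> _] := reP (1 + r / `|Re y|) y 0; apply: big.
apply: connected_component_trans (corner _ sy).
apply: connected_component_segmentC => t /andP[t0 t1].
rewrite /segmentC [_.1]/= [_.2]/= !mulr0 addr0 mulrA -rmorphM -mulrDl -rmorphD.
split; first by rewrite [_.1]/= cabs0 cabs_ge0.
rewrite [_.2]/= cabsM cabs_real.
apply: le_trans ry _; rewrite ler_peMl ?(ltW y0) //.
by apply: le_trans (ler_norm _); nra.
Qed.

End Connectedness.

(** * The equation phi (f z) = phi z ^ D up to a constant factor *)

Section FunctionalEquation.
Variable R : realType.
Notation C := (R[i]^o).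
Notation C2 := (C * C)%type.

Lemma finite_unity_roots n : (0 < n)%N ->
  finite_set [set z : C | z ^+ n = 1].
Proof.
move=> n0; have [s sP] := closed_field_poly_normal ('X^n - 1 : {poly R[i]}).
apply: (sub_finite_set _ (finite_seq s)) => z /= zn.
have : root ('X^n - 1) (z : R[i]) by rewrite /root !hornerE zn subrr.
rewrite sP rootZ ?root_prod_XsubC //.
by rewrite lead_coef_eq0 -size_poly_eq0 size_XnsubC.
Qed.

(** The image of A is connected and consists of finitely many roots of unity. Finite sets are
    closed, so one value is separated from all the others, and there can be no others. *)
Lemma unity_root_constant (T : topologicalType) (A : set T) (g : T -> C) n :
  (0 < n)%N -> connected A -> {within A, continuous g} ->
  (forall x, A x -> g x ^+ n = 1) ->
  forall x y, A x -> A y -> g x = g y.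
Proof.
move=> n0 cA cg g1 x y Ax Ay.
have cgA := connected_continuous_connected cA cg.
have fgA : finite_set (g @` A).
  by apply: sub_finite_set (finite_unity_roots n0) => _ [z Az <-]; exact: g1.
have fcl : forall B : set C, finite_set B -> closed B.
  apply/accessible_finite_set_closed/hausdorff_accessible.
  exact: norm_hausdorff.
pose B := (g @` A) `\ g x.
have fB : finite_set B by apply: sub_finite_set fgA => z [].
have sep : separated [set g x] B.
  rewrite /separated.
  rewrite -(proj1 (closure_id _) (fcl _ fB)).
  rewrite -(proj1 (closure_id _) (fcl _ (finite_set1 (g x)))).
  by split; apply/seteqP; split => // z [-> [_ /(_ erefl)]].
have cov : g @` A `<=` [set g x] `|` B.
  by move=> z Az; have [->|/eqP zx] := eqVneq z (g x); [left|right].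
have [H|H] := connected_subset sep cov cgA.
  by have /esym := H (g y) (imageP _ Ay).
by have [_ /(_ erefl)] := H (g x) (imageP _ Ax).
Qed.

Lemma horner_continuous (p : {poly R[i]}) : continuous (fun y : C => p.[y] : C).
Proof.
elim/poly_ind: p => [|p c IHp] y.
  rewrite /continuous_at horner0 (_ : (fun y => _) = fun=> 0 : C).
    exact: (@cvg_cst C _ _ _ (nbhs_filter (y : C))).
  by apply/funext => t; rewrite horner0.
rewrite /continuous_at hornerMXaddC.
rewrite (_ : (fun y => _) = (fun t : C => p.[t] : C) \* id + fun=> c : C).
  have F : Filter (nbhs (y : C)) := nbhs_filter (y : C).
  have H := @cvgM _ _ _ F _ _ _ _ (IHp y) (@cvg_id _ _).
  have H2 := @cvgD _ _ _ _ F _ _ _ _ H (@cvg_cst C c _ _ F).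
  exact: H2.
by apply/funext => t; rewrite hornerMXaddC.
Qed.

Lemma gen_henon_continuous (p : {poly R[i]}) (a : C) :
  continuous (gen_henon p a : C2 -> C2).
Proof.
move=> z; have F : Filter (nbhs (z : C2)) := nbhs_filter (z : C2).
have F1 : Filter (nbhs (z.1 : C)) := nbhs_filter (z.1 : C).
have F2 : Filter (nbhs (z.2 : C)) := nbhs_filter (z.2 : C).
have s1 : (u.1 : C) @[u --> (z : C2)] --> (z.1 : C).
  exact: (@cvg_fst _ _ (nbhs (z.1 : C)) (nbhs (z.2 : C)) F2).
have s2 : (u.2 : C) @[u --> (z : C2)] --> (z.2 : C).
  exact: (@cvg_snd _ _ (nbhs (z.1 : C)) (nbhs (z.2 : C)) F1).
have c1 := cvg_comp _ _ s2 (@horner_continuous p (z.2 : C)).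
have c2 := @cvgM _ _ _ F _ _ _ _ (@cvg_cst C a _ _ F) s1.
have c3 := @cvgB _ _ _ _ F _ _ _ _ c1 c2.
have F3 : Filter (nbhs (p.[z.2] - a * z.1 : C)) := nbhs_filter (_ : C).
exact: (@cvg_pair C2 C C (nbhs z) (nbhs z.2) 
  (nbhs (p.[z.2] - a * z.1 : C)) F F2 F3
  snd (fun u : C2 => p.[u.2] - a * u.1 : C) s2 c3).
Qed.

(* The quotient of [rho n.+1 z ^+ D] by [rho n (f z)] is continuous on the
   connected set V^+ and its [D ^ n]-th power is 1, so that it is constant. *)
Lemma phi_functional_eq (f : C2 -> C2) (D : nat) (r : R)
    (rho : nat -> C2 -> C) (phi : C2 -> C) :
  (0 < D)%N -> 0 < r -> continuous f ->
  (forall z, Vplus r z -> Vplus r (f z)) ->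
  (forall n, {within Vplus r, continuous (rho n)}) ->
  (forall n z, Vplus r z -> rho n z ^+ (D ^ n) = (iter n f z).2) ->
  (forall z, Vplus r z -> rho n z @[n --> \oo] --> phi z) ->
  forall z w, Vplus r z -> Vplus r w ->
    phi z ^+ D * phi (f w) = phi w ^+ D * phi (f z).
Proof.
move=> D0 r0 cf fV crho rhoE rho_phi z w Vz Vw.
have y_neq0 u : Vplus r u -> u.2 != 0.
  by move=> [_ ru]; rewrite -cabs_gt0 (lt_le_trans r0).
have iterV n u : Vplus r u -> Vplus r (iter n f u).
  by move=> Vu; elim: n => //= n; exact: fV.
have rho_neq0 n u : Vplus r u -> rho n u != 0.
  move=> Vu; apply/eqP => ru0; have := rhoE n u Vu.
  rewrite ru0 expr0n expn_eq0 -[D == 0]negbK -lt0n D0 /= => /esym/eqP.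
  by apply/negP/y_neq0/iterV.
have rhoEn n : rho n.+1 z ^+ D * rho n (f w) = rho n.+1 w ^+ D * rho n (f z).
  pose g u := rho n.+1 u ^+ D / rho n (f u).
  suff : g z = g w.
    rewrite /g => /eqP; rewrite eqr_div ?rho_neq0 //; do ?exact: fV.
    by move=> /eqP.
  apply: (@unity_root_constant _ (Vplus r) g (D ^ n)) => //.
  - by rewrite expn_gt0 D0.
  - exact: Vplus_connected.
  - apply/subspace_continuousP => u Vu.
    have fW : f x @[x --> within (Vplus r) (nbhs u)] -->
        within (Vplus r) (nbhs (f u)).
      move=> P /cf; apply: (@filterS _ (nbhs (u : C2))) => x Px Vx.
      by apply: Px; exact: fV.
    have F : Filter (within (Vplus r) (nbhs (u : C2))).
      exact: (within_filter _ (nbhs_filter (u : C2))).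
    have r1 :
        rho n.+1 x @[x --> within (Vplus r) (nbhs (u : C2))] --> rho n.+1 u.
      exact: (proj1 (subspace_continuousP _ _) (crho n.+1) u Vu).
    have r2 : rho n x @[x --> within (Vplus r) (nbhs (f u))] --> rho n (f u).
      exact: (proj1 (subspace_continuousP _ _) (crho n) (f u) (fV _ Vu)).
    have r3 := @cvgV _ _ _ F _ _ (rho_neq0 n _ (fV _ Vu)) (cvg_comp _ _ fW r2).
    exact: (@cvgM _ _ _ F _ _ _ _ (@cvg_exprn _ _ _ F _ _ D r1) r3).
  - move=> u Vu; rewrite /g expr_div_n -exprM -expnS !rhoE //; last exact: fV.
    by rewrite -iterSr divff // y_neq0 //; exact: iterV.
have cvgs u : Vplus r u -> rho n.+1 u ^+ D @[n --> \oo] --> phi u ^+ D.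
  move=> Vu; apply: cvg_exprn.
  by rewrite (cvg_shiftS (rho ^~ u)); exact: rho_phi.
(* The cross-multiplied identity passes to the limit without knowing that [phi] has no zeros. *)
have c1 := cvgM (cvgs _ Vz) (rho_phi _ (fV _ Vw)).
have c2 := cvgM (cvgs _ Vw) (rho_phi _ (fV _ Vz)).
have e : (fun n => rho n.+1 z ^+ D) \* (fun n => rho n (f w)) =
   (fun n => rho n.+1 w ^+ D) \* (fun n => rho n (f z)).
  by apply/funext => n; exact: rhoEn.
move: c1; rewrite e => c1.
exact: (@cvg_unique _ (@norm_hausdorff _ C) _ _ _ _ (c1 _) (c2 _)).
Qed.

End FunctionalEquation.

(** * Expansion of the power maps, and 1 as a repelling fixed point *)

Section UnityRatio.
Variable R : realType.
Implicit Types u y : R[i].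

(** The cofactor of u - 1 is 1 + u + ... + u^(d-1); near 1 each term is within 1/10 of 1, so the sum
    has modulus at least (9/10) d >= 9/5. One [del] serves all degrees up to [D]. *)
Lemma expB1_ge (D : nat) : exists2 del : R, 0 < del <= 1 &
  forall d u, (2 <= d <= D)%N -> cabs (u - 1) <= del ->
    9/5 * cabs (u - 1) <= cabs (u ^+ d - 1).
Proof.
pose M : R := D.+1%:R * 2 ^+ D.
have M1 : 1 <= M.
  have : 1 <= D.+1%:R :> R by rewrite ler1n.
  by move=> h; apply: mulr_ege1 => //; apply: exprn_ege1; lra.
(* Since |u| <= 2, one has |u^i - 1| <= i 2^i |u - 1| <= M |u - 1| for i < d <= D, and [del] makes
   this at most 1/10. *)
exists (1 / (10 * M)).
  by apply/andP; split; [rewrite divr_gt0 //|rewrite ler_pdivrMr //]; lra.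
move=> d u /andP[d2 dD] u1; rewrite subrX1 cabsM mulrC ler_wpM2l ?cabs_ge0 //.
have u2 : cabs u <= 2.
  have := cabs_subl u 1; rewrite cabs1.
  have : 1 / (10 * M) <= 1 by rewrite ler_pdivrMr //; lra.
  lra.
have close i : (i < d)%N -> cabs (u ^+ i - 1) <= 1/10.
  move=> id; rewrite -[X in _ - X](expr1n _ i).
  apply: le_trans (cabs_expB_le i _ u2 _) _; rewrite ?cabs1; try lra.
  apply: (@le_trans _ _ (M * (1 / (10 * M)))); last first.
    by rewrite le_eqVlt; apply/orP; left; apply/eqP; field; lra.
  rewrite ler_pM ?mulr_ge0 ?cabs_ge0 ?exprn_ge0 //.
  rewrite ler_pM ?exprn_ge0 //; first by rewrite ler_nat; lia.
  rewrite ler_weXn2l //; [lra|lia].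
have : cabs (\sum_(i < d) (u ^+ i - 1)) <= d%:R * (1/10).
  apply: le_trans (cabs_sum _) _.
  rewrite mulr_natl -[d in X in _ *+ X]card_ord -sumr_const.
  by apply: ler_sum => i _; exact: close.
rewrite sumrB sumr_const card_ord => h.
have := cabs_subr (\sum_(i < d) u ^+ i) d%:R; rewrite cabs_nat.
have : 2 <= d%:R :> R by rewrite ler_nat.
lra.
Qed.

(** The bound at 1 is applied to u = y' / y and multiplied by |y|^d. *)
Lemma expB_ge (D : nat) : exists2 del : R, 0 < del <= 1 &
  forall d y y', (2 <= d <= D)%N -> cabs (y' - y) <= del * cabs y ->
    9/5 * cabs y ^+ d.-1 * cabs (y' - y) <= cabs (y' ^+ d - y ^+ d).
Proof.
have [del del01 delP] := expB1_ge D; exists del => // d y y' dD yy'.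
have [y0|y0] := eqVneq y 0.
  move: yy'; rewrite y0 cabs0 mulr0 => h.
  have -> : cabs (y' - 0) = 0 by apply/eqP; rewrite eq_le h cabs_ge0.
  by rewrite mulr0 cabs_ge0.
have Y0 : 0 < cabs y by rewrite cabs_gt0.
have E : y' - y = (y' / y - 1) * y by field.
have u1 : cabs (y' / y - 1) <= del by rewrite -(ler_pM2r Y0) -cabsM -E.
have -> : y' ^+ d - y ^+ d = ((y' / y) ^+ d - 1) * y ^+ d.
  by rewrite expr_div_n mulrBl mul1r divfK // expf_neq0.
rewrite E !cabsM cabsX; have := delP d _ dD u1.
case: d dD => // d _; rewrite [cabs y ^+ _.+1]exprSr /= => H.
have := ler_wpM2r (mulr_ge0 (exprn_ge0 d (ltW Y0)) (ltW Y0)) H.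
by apply: le_trans; rewrite -subr_ge0 le_eqVlt;
   apply/orP; left; apply/eqP; ring.
Qed.

(** While t_n stays within [del] of 1, its distance to 1 grows at least by the factor 9/5 at each
    step, so a nonzero distance would leave the [del]-disk. *)
Lemma unity_expn_cvg (D : nat) (t : nat -> R[i]) : (2 <= D)%N ->
  (forall n, t n.+1 = t n ^+ D) ->
  (t n : R[i]^o) @[n --> \oo] --> (1 : R[i]^o) ->
  exists n, t n = 1.
Proof.
move=> D2 tS /cvg_cabsP t1.
have [del /andP[del0 _] delP] := expB1_ge D.
have [N _ NP] := t1 _ del0.
have grow n : (9/5) ^+ n * cabs (t N - 1) <= cabs (t (N + n)%N - 1).
  elim: n => [|n IHn]; first by rewrite mul1r addn0.
  rewrite addnS tS exprS -mulrA.
  apply: le_trans (delP D _ _ (NP _ _));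
    rewrite ?D2 ?leqnn //=; last exact: leq_addr.
  by rewrite ler_pM2l //; lra.
(* Bernoulli's inequality for 9/5 = 1 + 4/5. *)
have gt2 n : 1 + n%:R * (4/5) <= (9/5 : R) ^+ n.
  elim: n => [|n IHn]; first by rewrite mul0r addr0.
  rewrite exprS -natr1; have : 0 <= n%:R :> R by []. nra.
exists N; apply/eqP; rewrite -subr_eq0 -cabs_eq0; apply/negPn/negP => tN.
have e0 : 0 < cabs (t N - 1) by rewrite lt_neqAle eq_sym tN cabs_ge0.
have [n nP] : exists n : nat, del / cabs (t N - 1) * 2 < n%:R.
  by exists (Num.truncn (del / cabs (t N - 1) * 2)).+1; exact: truncnS_gt.
have := le_trans (grow n) (NP _ (leq_addr n N)).
have : n%:R * (1 / 2) * cabs (t N - 1) <= (9/5 : R) ^+ n * cabs (t N - 1).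
  by rewrite ler_pM2r //; have := gt2 n; have : 0 <= n%:R :> R by []; lra.
have : del < n%:R * (1/2) * cabs (t N - 1).
  by rewrite -ltr_pdivrMr //; lra.
lra.
Qed.

End UnityRatio.

(** * Orbits under a sequence of Hénon factors: growth and escape *)

Section Orbits.
Variables (R : realType) (d : nat -> nat) (p : nat -> {poly R[i]}).
Variables (a : nat -> R[i]) (K r : R).
Hypotheses (d_ge2 : forall k, (2 <= d k)%N).
Hypotheses (boundK : forall k, henon_bound K (d k) (p k) (a k)).
Hypotheses (r_ge : 10 * K + 10 <= r).
Notation C := (R[i]^o).
Notation C2 := (C * C)%type.
Implicit Types z w : C2.

(** One step applies a single factor, so the first coordinate at time k+1 is the second one at time
    k; the iterates of the composition appear at the multiples of m. *)
Fixpoint orb (k : nat) (z : C2) : C2 :=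
  if k is k'.+1 then gen_henon (p k') (a k') (orb k' z) else z.

Lemma orb_Vplus z j k : (j <= k)%N -> Vplus r (orb j z) -> Vplus r (orb k z).
Proof.
move=> jk Vz; rewrite -(subnKC jk); elim: (k - j)%N => [|n IHn].
  by rewrite addn0.
by rewrite addnS /=;
  have [] := Vplus_step (d_ge2 (j + n)) (boundK (j + n)) r_ge IHn.
Qed.

Lemma K_ge0 : 0 <= K. Proof. by have [] := boundK 0. Qed.

Lemma orb_ge z k : Vplus r z -> 2 ^+ k <= cabs (orb k z).2.
Proof.
move=> Vz; elim: k => [|k IHk].
  have [_ zr] := Vz; have := K_ge0; rewrite expr0 [orb 0 z]/= => K0.
  by apply: le_trans zr; have := r_ge; lra.
have Vk : Vplus r (orb k z) := @orb_Vplus z 0 k isT Vz.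
have [_ h _ _] := Vplus_step (d_ge2 k) (boundK k) r_ge Vk.
by rewrite exprS; apply: le_trans h; lra.
Qed.

Lemma orb_ge_snd z k : Vplus r z -> cabs z.2 <= cabs (orb k z).2.
Proof.
move=> Vz; elim: k => [|k IHk] //.
have Vk : Vplus r (orb k z) := @orb_Vplus z 0 k isT Vz.
have [_ h _ _] := Vplus_step (d_ge2 k) (boundK k) r_ge Vk.
by apply: le_trans h; have := cabs_ge0 z.2; lra.
Qed.

Lemma orb_unbounded z (M : R) :
  Vplus r z -> \forall k \near \oo, M <= cabs (orb k z).2.
Proof.
move=> Vz; near=> k; apply: le_trans (orb_ge k Vz).
apply: (@le_trans _ _ k%:R).
  by near: k; exact: nbhs_infty_ger.
have : k%:R <= 2 ^+ k :> R by rewrite -natrX ler_nat ltnW // ltn_expl.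
have : 0 <= k%:R :> R by [].
lra.
Unshelve. all: by end_near. Qed.

(* The square in the growth of the second coordinate beats every fixed rate. *)
Lemma orb_growth z (M L : R) : Vplus r z -> 1 <= L ->
  \forall k \near \oo, M * L ^+ k <= cabs (orb k z).2.
Proof.
move=> Vz L1.
have [N _ NP] := orb_unbounded (3 * L) Vz.
(* Beyond |y| >= 3 L one step gives at least (9/10) |y|^2 >= 2 L |y|. *)
have geo n : (2 * L) ^+ n <= cabs (orb (N + n) z).2.
  elim: n => [|n IHn].
    rewrite expr0; apply: le_trans (NP _ (leq_addr _ _)); lra.
  have VNn : Vplus r (orb (N + n) z) := @orb_Vplus z 0 (N + n) isT Vz.
  have [_ _ h _] := Vplus_step (d_ge2 _) (boundK (N + n)) r_ge VNn.
  rewrite addnS exprS; apply: le_trans h.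
  have y3 := NP (N + n)%N (leq_addr n N); rewrite /= in y3.
  set y := cabs _ in IHn y3 *.
  have y1 : 1 <= y by lra.
  have : y ^+ 2 <= y ^+ d (N + n) by rewrite ler_weXn2l.
  have : 2 * L * (2 * L) ^+ n <= 2 * L * y by rewrite ler_pM2l //; lra.
  have : 3 * L * y <= y * y by rewrite ler_pM2r //; lra.
  rewrite expr2; nra.
near=> k; have Nk : (N <= k)%N by near: k; exists N.
have -> : orb k z = orb (N + (k - N)) z by rewrite subnKC.
apply: le_trans (geo _).
rewrite -{1}(subnKC Nk) exprMn exprD mulrA ler_wpM2r ?exprn_ge0 //; first lra.
(* With L^(k-N) cancelled, it remains that 2^(k-N) beats the constant M L^N. *)
apply: (@le_trans _ _ (k - N)%:R); last first.
  by rewrite -natrX ler_nat ltnW // ltn_expl.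
rewrite natrB // lerBrDr.
by near: k; exact: nbhs_infty_ger.
Unshelve. all: by end_near. Qed.

(** An orbit that avoids V^+ keeps both coordinates below B = max(|x|, |y|, r): a new second
    coordinate above B would exceed r and the old one, which puts the new point in V^+. *)
Lemma orb_escape z : (forall M, exists k, M < norm2 (orb k z)) ->
  exists k, Vplus r (orb k z).
Proof.
move=> unb; apply: contrapT => /forallNP nV.
pose B := Num.max (cabs z.1) (Num.max (cabs z.2) r).
have bnd k : cabs (orb k z).1 <= B /\ cabs (orb k z).2 <= B.
  elim: k => [|k [IH1 IH2]].
    by rewrite /= /B !le_max !lexx orbT.
  split => //=; rewrite leNgt; apply/negP => h; apply: (nV k.+1).
  split => /=; first exact: le_trans IH2 (ltW h).
  by apply: le_trans (ltW h); rewrite /B !le_max lexx !orbT.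
have [k] := unb (B + B).
have [h1 h2] := bnd k; have := norm2_le (orb k z); lra.
Qed.

End Orbits.

(** * Contraction of the differences of two orbits in V^+ *)

Section Contraction.
Variables (R : realType) (d : nat -> nat) (p : nat -> {poly R[i]}).
Variables (a : nat -> R[i]) (K r : R) (D : nat).
Hypotheses (d_ge2 : forall k, (2 <= d k)%N).
Hypotheses (d_le : forall k, (d k <= D)%N).
Hypotheses (boundK : forall k, henon_bound K (d k) (p k) (a k)).
Hypotheses (r_ge : 10 * K + 10 <= r).
Notation C := (R[i]^o).
Notation C2 := (C * C)%type.
Notation orb := (orb p a).
Implicit Types z w : C2.

(** The bound comes from the future: as c is nonincreasing, n uses of the recurrence give e_k <=
    (2/3)^n + (1 + 2/3 + (2/3)^2 + ...) c_k, and n tends to infinity. *)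
Lemma backward_contraction (e c : nat -> R) (N : nat) :
  (forall k, (N <= k)%N -> e k <= 1) ->
  (forall k, (N <= k)%N -> 0 <= c k) ->
  (forall k, (N <= k)%N -> c k.+1 <= c k) ->
  (forall k, (N <= k)%N -> e k <= 2/3 * e k.+1 + c k) ->
  forall k, (N <= k)%N -> e k <= 3 * c k.
Proof.
move=> e1 c0 cS eS.
have H n k : (N <= k)%N -> e k <= (2/3) ^+ n + 3 * c k.
  elim: n k => [|n IHn] k Nk.
    by rewrite expr0; have := e1 _ Nk; have := c0 _ Nk; lra.
  have := IHn k.+1 (leqW Nk); have := eS _ Nk; have := cS _ Nk.
  by rewrite exprS; lra.
move=> k Nk; apply/ler_addgt0Pl => eps eps0.
have /cvgrPdist_le/(_ _ eps0)[n _ /(_ n (leqnn n))] :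
    (2/3 : R) ^+ n @[n --> \oo] --> 0.
  by apply: cvg_expr; rewrite ger0_norm; lra.
have q0 : 0 <= (2/3 : R) ^+ n by apply: exprn_ge0; lra.
rewrite /= sub0r normrN ger0_norm //.
by move=> n_eps; apply: le_trans (H n k Nk) _; rewrite lerD.
Qed.

(** The power y^d contributes the expansion (9/5) |y|^(d-1), and the lower-order part takes away at
    most K |y|^(d-2) <= |y|^(d-1) / 10, which leaves 17/10. The term in x goes to the right-hand
    side. *)
Lemma henon_expand : exists2 del : R, 0 < del <= 1 &
  forall k (x x' y y' : R[i]), 10 * K + 10 <= cabs y ->
    cabs (y' - y) <= del * cabs y ->
    17/10 * cabs y ^+ (d k).-1 * cabs (y' - y) <=
      cabs (((p k).[y'] - a k * x') - ((p k).[y] - a k * x))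
        + K * cabs (x' - x).
Proof.
have [del del01 delP] := expB_ge R D; exists del => // k x x' y y' yK yy'.
have dk : (2 <= d k <= D)%N by rewrite d_ge2 d_le.
have H1 := delP _ _ _ dk yy'.
have [K0 aK _ lip] := boundK k.
have y1 : 1 <= cabs y by lra.
have y'2 : cabs y' <= 2 * cabs y.
  have := cabs_subl y' y; have /andP[_ del1] := del01.
  have : del * cabs y <= 1 * cabs y by rewrite ler_wpM2r //; lra.
  lra.
have H2 := lip _ _ y1 y'2.
have E : y' ^+ d k - y ^+ d k =
    (((p k).[y'] - a k * x') - ((p k).[y] - a k * x)) +
    (((p k).[y] - y ^+ d k) - ((p k).[y'] - y' ^+ d k)) 
    + a k * (x' - x) by ring.
have H3 : cabs (y' ^+ d k - y ^+ d k) <=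
    cabs (((p k).[y'] - a k * x') - ((p k).[y] - a k * x)) +
    K * cabs y ^+ (d k).-2 * cabs (y - y') + K * cabs (x' - x).
  rewrite E; apply: le_trans (cabsD _ _) _; rewrite lerD //.
    by apply: le_trans (cabsD _ _) _; rewrite lerD.
  by rewrite cabsM ler_wpM2r ?cabs_ge0.
have H4 : K * cabs y ^+ (d k).-2 * cabs (y - y') <=
    1/10 * cabs y ^+ (d k).-1 * cabs (y' - y).
  rewrite [cabs (y - y')]cabsC ler_wpM2r ?cabs_ge0 //.
  have := d_ge2 k; case: (d k) => [|[|n]] //= _.
  by rewrite exprS mulrA ler_wpM2r ?exprn_ge0 //; lra.
lra.
Qed.

Lemma orb_contract z w : Vplus r z -> Vplus r w ->
  (forall del : R, 0 < del -> \forall k \near \oo,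
    cabs ((orb k w).2 - (orb k z).2) <= del * cabs (orb k z).2) ->
  \forall k \near \oo,
    cabs ((orb k.+1 w).2 - (orb k.+1 z).2) <= 3 * K / cabs (orb k z).2.
Proof.
move=> Vz Vw zw; have rK := r_ge.
have [del /andP[del0 del1] delP] := henon_expand.
have [N _ NP] := zw _ del0.
have K0 : 0 <= K := K_ge0 boundK.
pose Y k := cabs (orb k z).2; pose E k := cabs ((orb k w).2 - (orb k z).2).
have VY k : Vplus r (orb k z) := orb_Vplus d_ge2 boundK r_ge (leq0n k) Vz.
have Y10 k : 10 <= Y k by have [_] := VY k; rewrite /Y; lra.
have YS k : [/\ 2 * Y k <= Y k.+1, 9/10 * Y k ^+ d k <= Y k.+1
    & Y k.+1 <= 11/10 * Y k ^+ d k].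
  by have [_ h1 h2 h3] := Vplus_step (d_ge2 k) (boundK k) r_ge (VY k).
(* [e k] is the relative difference at time k+1, so [e k <= 3 * c k] multiplied by [Y k.+1] is the
   claim. *)
pose e k := E k.+1 / Y k.+1; pose c k := K / (Y k * Y k.+1).
have main k : (N <= k)%N -> e k <= 3 * c k.
  apply: backward_contraction => {}k Nk.
  - rewrite /e ler_pdivrMr; last by have := Y10 k.+1; lra.
    apply: le_trans (NP _ _) _ => /=; first exact: leqW.
    by rewrite ler_wpM2r ?cabs_ge0.
  - by rewrite /c divr_ge0 // mulr_ge0 // cabs_ge0.
  - have [s1 _ _] := YS k; have [s2 _ _] := YS k.+1.
    have := Y10 k; have := Y10 k.+1; have := Y10 k.+2 => y2 y1 y0.
    rewrite /c ler_wpM2l // lef_pV2 ?posrE ?mulr_gt0 //; try lra.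
    by rewrite ler_pM //; lra.
  - have [_ s1 _] := YS k; have [_ _ s2] := YS k.+1.
    have y0 := Y10 k; have y1 := Y10 k.+1; have y2 := Y10 k.+2.
    have E0 : E k <= Y k.
      apply: le_trans (NP _ Nk) _; rewrite -/(Y k) -[leRHS]mul1r.
      by rewrite ler_wpM2r //; lra.
    (* The first coordinates at time k+1 are the second ones at time k, hence the term [K * E k]. *)
    have X : 17/10 * Y k.+1 ^+ (d k.+1).-1 * E k.+1 <= E k.+2 + K * E k.
      apply: (@delP k.+1 (orb k.+1 z).1 (orb k.+1 w).1).
        by have [_] := VY k.+1; lra.
      exact: NP _ (leqW Nk).
    have Y0P : Y k ^+ 2 <= 10/9 * Y k.+1.
      have : Y k ^+ 2 <= Y k ^+ d k by rewrite ler_weXn2l ?d_ge2 //; lra.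
      lra.
    have E1 : E k.+1 = e k * Y k.+1 by rewrite /e divfK //; lra.
    have E2 : E k.+2 = e k.+1 * Y k.+2 by rewrite /e divfK //; lra.
    have e1_ge0 : 0 <= e k.+1 by rewrite /e divr_ge0 ?cabs_ge0.
    have c_ge0 : 0 <= c k by rewrite /c divr_ge0 // mulr_ge0 // cabs_ge0.
    have cK : K = c k * (Y k * Y k.+1) by rewrite /c divfK // mulf_neq0; lra.
    have KE : K * E k <= c k * (10/9 * Y k.+1 * Y k.+1).
      apply: (@le_trans _ _ (K * Y k)); first by rewrite ler_wpM2l.
      rewrite {1}cK -mulrA ler_wpM2l //.
      have Y1_ge0 : 0 <= Y k.+1 by lra.
      by have := ler_wpM2r Y1_ge0 Y0P; rewrite expr2; lra.
    have [P [PY PYd]] : exists P, [/\ Y k.+1 <= P,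
        Y k.+1 ^+ (d k.+1).-1 = P & Y k.+1 ^+ d k.+1 = P * Y k.+1].
      exists (Y k.+1 ^+ (d k.+1).-1); split => //.
        have := d_ge2 k.+1; case: (d k.+1) => [|[|n]] //= _.
        by rewrite exprS ler_peMr ?exprn_ege1 //; lra.
      by rewrite -exprSr prednK // ltnW // d_ge2.
    move=> PYd'; rewrite PYd' in s2; rewrite PYd E1 E2 in X.
    have P0 : 0 < P by lra.
    have H1 : e k.+1 * Y k.+2 <= e k.+1 * (11/10 * (P * Y k.+1)).
      by rewrite ler_wpM2l.
    have H2 : c k * (10/9 * Y k.+1 * Y k.+1) <= c k * (10/9 * P * Y k.+1).
      by rewrite ler_wpM2l // ler_wpM2r ?ler_wpM2l //; lra.
    have PY0 : 0 < P * Y k.+1 by rewrite mulr_gt0 //; lra.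
    (* Division by 17/10 turns the coefficients into 11/17 <= 2/3 and 100/153 <= 1. *)
    have : 17/10 * e k * (P * Y k.+1) <=
        (11/10 * e k.+1 + 10/9 * c k) * (P * Y k.+1) by lra.
    by rewrite ler_pM2r //; lra.
exists N => // k /= Nk; have := main k Nk; rewrite /e /c.
have y1 := Y10 k.+1; have y0 := Y10 k.
rewrite ler_pdivrMr; last lra.
move=> h; apply: le_trans h _; rewrite le_eqVlt; apply/orP; left; apply/eqP.
rewrite /Y in y0 y1 *; field; lra.
Qed.

End Contraction.

(** * Super-exponential decay and the extended logarithm *)

Section SuperExponential.
Variable R : realType.

Lemma cvg_lneNy (del : nat -> R) :
  (forall L : R, 1 <= L -> \forall n \near \oo, del n <= L ^- n) ->
  ((n%:R^-1)%:E * lne (del n)%:E)%E @[n --> \oo] --> -oo%E.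
Proof.
(* For L = exp B the hypothesis reads log (del n) / n <= - B when del n > 0; this B gives both - B
   <= A and L >= 1. *)
move=> H; apply/cvgeNyPler => A _; pose B := Num.max 0 (- A).
have B0 : 0 <= B by rewrite /B le_max lexx.
have AB : - B <= A by rewrite lerNl /B le_max lexx orbT.
have L1 : 1 <= expR B by rewrite -expR0 ler_expR.
near=> n.
have n0 : 0 < n%:R :> R by rewrite ltr0n; near: n; exists 1%N.
have nV0 : 0 < n%:R^-1 :> R by rewrite invr_gt0.
(* A nonpositive [del n] has extended logarithm -oo, and 1/n > 0 preserves it. *)
have [d0|d0] := leP (del n) 0.
  by rewrite le0_lneNy ?lee_fin // gt0_muleNy ?lte_fin ?leNye.
rewrite lne_EFin // -EFinM lee_fin mulrC ler_pdivrMr //.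
apply: le_trans (_ : - B * n%:R <= _); last by rewrite ler_wpM2r.
rewrite -ler_expR lnK ?posrE // mulNr expRN mulrC expRM_natl.
by near: n; exact: H.
Unshelve. all: by end_near. Qed.

(** The passage from the super-stable manifold to the leaf starts from this boundedness of the
    distances. *)
Lemma cvg_lneNy_le1 (del : nat -> R) :
  ((n%:R^-1)%:E * lne (del n)%:E)%E @[n --> \oo] --> -oo%E ->
  \forall n \near \oo, del n <= 1.
Proof.
move=> /cvgeNyPler/(_ 0 (real0 _)) H; near=> n.
have n0 : 0 < n%:R :> R by rewrite ltr0n; near: n; exists 1%N.
have nV0 : 0 < n%:R^-1 :> R by rewrite invr_gt0.
have : ((n%:R^-1)%:E * lne (del n)%:E <= 0%:E)%E by near: n.
have [d0|d0] := leP (del n) 0; first by move=> _; lra.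
rewrite lne_EFin // -EFinM lee_fin pmulr_rle0 // => ln0.
by rewrite leNgt; apply/negP => /ln_gt0; lra.
Unshelve. all: by end_near. Qed.

End SuperExponential.

(** * Asymptotics of the second coordinate along orbits *)

Section OrbitAsymptotics.
Variables (R : realType) (d : nat -> nat) (p : nat -> {poly R[i]}).
Variables (a : nat -> R[i]) (K r : R) (D : nat).
Hypotheses (d_ge2 : forall k, (2 <= d k)%N).
Hypotheses (d_le : forall k, (d k <= D)%N).
Hypotheses (boundK : forall k, henon_bound K (d k) (p k) (a k)).
Hypotheses (r_ge : 10 * K + 10 <= r).
Notation C := (R[i]^o).
Notation C2 := (C * C)%type.
Notation orb := (orb p a).
Implicit Types z w : C2.

(** Each factor raises the second coordinate to its degree up to a factor tending to 1, and
    asymptotic equivalence is stable under fixed powers. Over one period this is the leading term of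
    the composition, which determines the constant in the functional equation. *)
Lemma orb_asymp (zn : nat -> C2) k : (forall n, Vplus r (zn n)) ->
  (forall M : R, \forall n \near \oo, M <= cabs (zn n).2) ->
  asymp (fun n => (orb k (zn n)).2)
        (fun n => (zn n).2 ^+ (\prod_(i < k) d i)%N).
Proof.
move=> Vzn znoo.
have VO j n : Vplus r (orb j (zn n)) :=
  orb_Vplus d_ge2 boundK r_ge (leq0n j) (Vzn n).
have oo j : forall M : R, \forall n \near \oo, M <= cabs (orb j (zn n)).2.
  move=> M; apply: filterS (znoo M) => n /le_trans; apply.
  exact: orb_ge_snd r_ge _ _ (Vzn n).
elim: k => [|k IHk].
  apply/asympP => e e0; near=> n; rewrite big_ord0 expr1 subrr cabs0.
  split; last by rewrite mulr_ge0 ?cabs_ge0 // ltW.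
  have : 1 <= cabs (zn n).2 by near: n; exact: znoo.
  by rewrite -cabs_gt0; lra.
apply: asymp_trans (_ : asymp _ (fun n => (orb k (zn n)).2 ^+ d k)) _.
  apply: (asymp_step (x := fun n => (orb k (zn n)).1)
    (d_ge2 k) (boundK k)) => //.
  by near=> n; have [] := VO k n.
rewrite big_ord_recr /=; move: IHk; set P := (\prod_(i < k) d i)%N => IHk.
have -> : (fun n => (zn n).2 ^+ (P * d k)) = (fun n => ((zn n).2 ^+ P) ^+ d k).
  by apply/funext => n; rewrite exprM.
exact: asympX.
Unshelve. all: by end_near. Qed.

(** * Comparison of two orbits when the factors repeat with period m *)

Section Periodic.
Variable m : nat.
Hypothesis m_gt0 : (0 < m)%N.
Hypotheses (p_per : forall n j, p (n * m + j)%N = p j).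
Hypotheses (a_per : forall n j, a (n * m + j)%N = a j).

(** By periodicity the step from time n m + j uses the same factor for all n, so the equivalence
    passes from j to j+1. *)
Lemma orb_asymp_shift z w j : Vplus r z -> Vplus r w ->
  asymp (fun n => (orb (n * m) w).2) (fun n => (orb (n * m) z).2) ->
  asymp (fun n => (orb (n * m + j) w).2) (fun n => (orb (n * m + j) z).2).
Proof.
move=> Vz Vw zw.
have VO u k : Vplus r u -> Vplus r (orb k u) :=
  orb_Vplus d_ge2 boundK r_ge (leq0n k).
have moo k : (n * m + k)%N @[n --> \oo] --> \oo.
  by apply/cvgnyPge => A; exists A => // n /= An; nia.
elim: j => [|j IHj].
  have E u : (fun n => (orb (n * m + 0) u).2) = (fun n => (orb (n * m) u).2).
    by apply/funext => n; rewrite addn0.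
  by rewrite !E.
have step u : Vplus r u -> asymp (fun n => (orb (n * m + j.+1) u).2)
    (fun n => (orb (n * m + j) u).2 ^+ d j).
  move=> Vu.
  have -> : (fun n => (orb (n * m + j.+1) u).2) =
      (fun n => (p j).[(orb (n * m + j) u).2] - a j * (orb (n * m + j) u).1).
    by apply/funext => n; rewrite addnS /= p_per a_per.
  apply: (asymp_step (x := fun n => (orb (n * m + j) u).1)
    (d_ge2 j) (boundK j)).
    move=> M; exact: (moo j _ (orb_unbounded d_ge2 boundK r_ge M Vu)).
  by near=> n; have [] := VO u (n * m + j)%N Vu.
apply: asymp_trans (step _ Vw) _; apply: asymp_trans (asympX _ IHj) _.
exact/asymp_sym/step.
Unshelve. all: by end_near. Qed.

(** A time k is n m + j with j < m, and the finitely many residues j share one threshold on n. *)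
Lemma orb_near_of_asymp z w : Vplus r z -> Vplus r w ->
  asymp (fun n => (orb (n * m) w).2) (fun n => (orb (n * m) z).2) ->
  forall del : R, 0 < del -> \forall k \near \oo,
    cabs ((orb k w).2 - (orb k z).2) <= del * cabs (orb k z).2.
Proof.
move=> Vz Vw zw del del0.
have [N _ NP] : \forall n \near \oo, forall j : 'I_m,
    cabs ((orb (n * m + j) w).2 - (orb (n * m + j) z).2)
      <= del * cabs (orb (n * m + j) z).2.
  apply: filter_forall => j.
  have /asympP/(_ _ del0) := orb_asymp_shift j Vz Vw zw.
  by apply: filterS => n [].
exists (N * m)%N => // k /= Nk; rewrite (divn_eq k m).
by apply: (NP _ _ (Ordinal (ltn_pmod k m_gt0))); rewrite /= leq_divRL.
Qed.

Lemma orb_dist_superexp z w (L : R) : Vplus r z -> Vplus r w -> 1 <= L ->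
  asymp (fun n => (orb (n * m) w).2) (fun n => (orb (n * m) z).2) ->
  \forall n \near \oo, dist (orb (n * m) z) (orb (n * m) w) <= L ^- n.
Proof.
move=> Vz Vw L1 zw.
have K0 : 0 <= K := K_ge0 boundK.
have H1 := orb_contract d_ge2 d_le boundK r_ge Vz Vw
  (orb_near_of_asymp Vz Vw zw).
(* The coordinates at time k+2 differ by at most 3 K / Y_k and 3 K / Y_(k+1), in total 6 K / Y_k,
   where Y_k is the modulus of the second coordinate of [orb k z]. The factor 6 K L^2 turns this
   into L^-(k+2), and the summand 1 ensures Y_k >= 1. *)
have H2 := orb_growth d_ge2 boundK r_ge (6 * K * L ^+ 2 + 1) Vz L1.
have [N1 _ NP1] := H1; have [N2 _ NP2] := H2.
have NP k : (maxn N1 N2 <= k)%N -> dist (orb k.+2 z) (orb k.+2 w) <= L ^- k.+2.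
  rewrite geq_max => /andP[k1 k2].
  have h0 := NP1 k k1; have h1 := NP1 k.+1 (leqW k1); have h2 := NP2 k k2.
  have Vk : Vplus r (orb k z) := orb_Vplus d_ge2 boundK r_ge (leq0n k) Vz.
  have [_ h3 _ _] := Vplus_step (d_ge2 k) (boundK k) r_ge Vk.
  have Lk : 1 <= L ^+ k by rewrite exprn_ege1.
  have L2 : 0 <= 6 * K * L ^+ 2 by rewrite !mulr_ge0 // ?exprn_ge0 //; lra.
  have Y0 : 1 <= cabs (orb k z).2.
    have := mulr_ge0 L2 (_ : 0 <= L ^+ k); rewrite /= in h2.
    by move=> /(_ (le_trans ler01 Lk)); lra.
  have Y01 : cabs (orb k z).2 <= cabs (orb k.+1 z).2.
    by have h4 : 2 * cabs (orb k z).2 <= cabs (orb k.+1 z).2 := h3; lra.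
  apply: le_trans (norm2_le _) _.
  change (cabs ((orb k.+1 z).2 - (orb k.+1 w).2) +
    cabs ((orb k.+2 z).2 - (orb k.+2 w).2) <= L ^- k.+2).
  rewrite [cabs ((orb k.+1 z).2 - _)]cabsC [cabs ((orb k.+2 z).2 - _)]cabsC.
  apply: le_trans (lerD h0 h1) _.
  apply: (@le_trans _ _ (6 * K / cabs (orb k z).2)).
    have : 3 * K / cabs (orb k.+1 z).2 <= 3 * K / cabs (orb k z).2.
      by rewrite ler_wpM2l ?mulr_ge0 // lef_pV2 ?posrE; lra.
    lra.
  rewrite ler_pdivrMr; last lra.
  have Lk2 : 0 < L ^+ k.+2 by rewrite exprn_gt0 //; lra.
  rewrite -(ler_pM2l Lk2) [leRHS]mulrA mulfV ?gt_eqF // mul1r.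
  apply: le_trans h2.
  have -> : L ^+ k.+2 = L ^+ 2 * L ^+ k by rewrite -exprD.
  lra.
exists (maxn N1 N2).+2 => // n /= Nn.
(* The time n m is at least 2, so it has the form k+2, and at least n, so L^-(n m) <= L^-n. *)
have nm : (n <= n * m)%N by rewrite leq_pmulr.
have nm2 : ((n * m - 2).+2 = n * m)%N by lia.
have /NP : (maxn N1 N2 <= n * m - 2)%N by lia.
rewrite nm2 => /le_trans; apply.
rewrite lef_pV2 ?posrE ?exprn_gt0 ?ler_weXn2l //; lra.
Qed.

End Periodic.
End OrbitAsymptotics.

(** * The composition as one period of the sequence of factors *)

Section Composition.
Variables (R : realType) (m : nat) (d : 'I_m -> nat).
Variables (p : 'I_m -> {poly R[i]}) (a : 'I_m -> R[i]).
Hypotheses (m_gt0 : (0 < m)%N).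
Notation C := (R[i]^o).
Notation C2 := (C * C)%type.
Notation f := (henon_comp p a).

(* The factor with the largest index is the one that acts first. *)
Definition step_index (k : nat) : 'I_m := rev_ord (Ordinal (ltn_pmod k m_gt0)).

Lemma step_index_per n j : step_index (n * m + j) = step_index j.
Proof. by apply/val_inj; rewrite /= modnMDl. Qed.

Lemma step_index_ord (j : 'I_m) : step_index j = rev_ord j.
Proof. by apply/val_inj; rewrite /= modn_small. Qed.

Notation orbs := (orb (p \o step_index) (a \o step_index)).

Lemma prod_step_index :
  (\prod_(i < m) (d \o step_index) i = \prod_(i < m) d i)%N.
Proof.
rewrite [RHS](reindex_inj rev_ord_inj) /=.
by apply: eq_bigr => i _; rewrite step_index_ord.
Qed.

Lemma henon_compE (z : C2) : f z = orbs m z.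
Proof.
(* [G i] is the i-th factor, written as the step number m - i - 1. The composition over the last j
   indices is then the first j steps, and each smaller index adds a factor on the left. *)
pose G i := gen_henon (p (step_index (m - i.+1))) (a (step_index (m - i.+1))).
have H j : (j <= m)%N -> orbs j z =
    (\big[(fun g h : C2 -> C2 => g \o h)/id]_(m - j <= i < m) G i) z.
  elim: j => [|j IHj] jm; first by rewrite subn0 big_geq.
  rewrite big_ltn; last by rewrite ltn_subrL.
  rewrite subnSK //= IHj; last exact: ltnW.
  by rewrite /G subnSK // subKn // ltnW.
rewrite H // subnn big_mkord /henon_comp; congr (_ z).
apply: eq_bigr => j _; rewrite /G; suff -> : step_index (m - j.+1) = j by [].
rewrite -[j in RHS]rev_ordK -step_index_ord.
by congr step_index.
Qed.

Lemma orb_iter n (z : C2) : orbs (n * m) z = iter n f z.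
Proof.
elim: n => [|n IHn] //; rewrite mulSnr iterS -IHn henon_compE.
have H j : orbs (n * m + j) z = orbs j (orbs (n * m) z); last exact: H.
elim: j => [|j IHj]; first by rewrite addn0.
by rewrite addnS /= step_index_per IHj.
Qed.

Lemma henon_comp_continuous : continuous (f : C2 -> C2).
Proof.
have -> : f = orbs m by apply/funext => z; exact: henon_compE.
have H k : continuous (orbs k); last exact: H.
elim: k => [|k IHk] z; first exact: cvg_id.
exact: (continuous_comp (IHk z) (@gen_henon_continuous _ _ _ _)).
Qed.

End Composition.

(** * Global leaves and super-stable manifolds *)

Section Leaves.
Variables (R : realType) (m : nat) (d : 'I_m -> nat).
Variables (p : 'I_m -> {poly R[i]}) (a : 'I_m -> R[i]) (K r : R).
Hypotheses (m_gt0 : (0 < m)%N) (d_ge2 : forall j, (2 <= d j)%N).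
Hypotheses (boundK : forall j, henon_bound K (d j) (p j) (a j)).
Hypotheses (r_ge : 10 * K + 10 <= r).
Notation C := (R[i]^o).
Notation C2 := (C * C)%type.
Notation f := (henon_comp p a).
Notation V := (Vplus r).
Notation D := (\prod_(j < m) d j)%N.
Notation idx := (step_index m_gt0).
Notation orbs := (orb (p \o idx) (a \o idx)).
Implicit Types z w u : C2.

Let ds_ge2 k : (2 <= (d \o idx) k)%N. Proof. exact: d_ge2. Qed.

Let ds_bound k : henon_bound K ((d \o idx) k) ((p \o idx) k) ((a \o idx) k).
Proof. exact: boundK. Qed.

Let ds_le k : ((d \o idx) k <= \max_j d j)%N.
Proof. exact: leq_bigmax. Qed.

Let ps_per n j : (p \o idx) (n * m + j)%N = (p \o idx) j.
Proof. by rewrite /= step_index_per. Qed.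

Let as_per n j : (a \o idx) (n * m + j)%N = (a \o idx) j.
Proof. by rewrite /= step_index_per. Qed.

Let r_ge10 : 10 <= r.
Proof. by have h := r_ge; have := K_ge0 ds_bound; lra. Qed.

Lemma degree_ge2 : (2 <= D)%N.
Proof.
rewrite (bigD1 (Ordinal m_gt0)) //= -[2%N]muln1 leq_mul //.
by apply: prodn_gt0 => j; exact: ltnW.
Qed.

Lemma iter_Vplus n k z : (n <= k)%N -> V (iter n f z) -> V (iter k f z).
Proof.
move=> nk; rewrite -!(orb_iter p a m_gt0);
  apply: (orb_Vplus ds_ge2 ds_bound r_ge).
by rewrite leq_mul2r nk orbT.
Qed.

Lemma Uplus_Vplus z : Uplus f z -> exists n, V (iter n f z).
Proof.
move=> Uz; have [|k Vk] := @orb_escape _ (p \o idx) (a \o idx) r z.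
  move=> M; apply: contrapT => /forallNP h; apply: Uz; exists M => n.
  by rewrite leNgt -(orb_iter p a m_gt0); apply/negP/h.
(* V^+ may be entered in the middle of an application of f; its invariance under the factors carries
   the entry from time k to time k m. *)
exists k; rewrite -(orb_iter p a m_gt0);
  apply: (orb_Vplus ds_ge2 ds_bound r_ge) Vk.
exact: leq_pmulr.
Qed.

Lemma iter_unbounded z (M : R) :
  V z -> \forall n \near \oo, M <= cabs (iter n f z).2.
Proof.
move=> Vz; have [N _ NP] := orb_unbounded ds_ge2 ds_bound r_ge M Vz.
exists N => // n /= Nn; rewrite -(orb_iter p a m_gt0); apply: NP.
by rewrite /= (leq_trans Nn) // leq_pmulr.
Qed.

Section Phi.
Variable phi : C2 -> C.
Hypothesis phiP : is_phi_plus f D r phi.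

Lemma phi_asymp (zn : nat -> C2) : (forall n, V (zn n)) ->
  (forall M : R, \forall n \near \oo, M <= cabs (zn n).2) ->
  asymp (fun n => phi (zn n)) (fun n => (zn n).2).
Proof.
move=> Vzn znoo; apply/asympP => e e0.
have [M MP] := proj2 phiP e e0.
near=> n; split; last by apply: MP => //; near: n; exact: znoo.
by rewrite -cabs_gt0; have [_] := Vzn n; have := r_ge10; lra.
Unshelve. all: by end_near. Qed.

(* Both sides are asymptotic to y^D at infinity, and their quotient is constant
   on V^+. *)
Lemma phi_comp z : V z -> phi (f z) = phi z ^+ D.
Proof.
move=> Vz; have r10 := r_ge10.
have fV u : V u -> V (f u) by exact: (@iter_Vplus 0 1 u).
have feq u w : V u -> V w -> phi u ^+ D * phi (f w) = phi w ^+ D * phi (f u).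
  have [[rho [crho rhoE rho_phi]] _] := phiP.
  apply: (@phi_functional_eq _ f D r rho phi) => //.
  - exact: leq_trans degree_ge2.
  - lra.
  - exact: henon_comp_continuous.
(* Test points tending to infinity along the y-axis. *)
pose zn n : C2 := (0, (r + n%:R)%:C%C).
have cabs_zn n : cabs (zn n).2 = r + n%:R.
  by rewrite cabs_real ger0_norm // addr_ge0 //; lra.
have Vzn n : V (zn n).
  by split; rewrite cabs_zn ?cabs0 ?addr_ge0 ?lerDl //; lra.
have znoo M : \forall n \near \oo, M <= cabs (zn n).2.
  near=> n; rewrite cabs_zn; have : M <= n%:R by near: n; exact: nbhs_infty_ger.
  lra.
have asf : asymp (fun n => (f (zn n)).2) (fun n => (zn n).2 ^+ D).
  have := orb_asymp ds_ge2 ds_bound r_ge m Vzn znoo.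
  by rewrite (prod_step_index d m_gt0);
    under eq_fun do rewrite -(henon_compE p a m_gt0).
have as1 : asymp (fun n => phi (f (zn n))) (fun n => phi (zn n) ^+ D).
  apply: asymp_trans (_ : asymp _ (fun n => (f (zn n)).2)) _.
    apply: (@phi_asymp (fun n => f (zn n))) => [n|M]; first exact: fV.
    apply: filterS (znoo M) => n /le_trans; apply.
    rewrite (henon_compE p a m_gt0).
    exact: (orb_ge_snd ds_ge2 ds_bound r_ge).
  apply: asymp_trans asf _; apply: asymp_sym; apply: asympX.
  exact: phi_asymp.
(* By [feq], phi(z)^D times phi(f z_n) / phi(z_n)^D equals phi(f z) as soon as phi(z_n) is nonzero,
   while the quotient tends to 1. *)
have c1 := @cvgM _ _ _ _ _ _ _ _ (@cvg_cst C (phi z ^+ D) _ \oo _) as1.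
have c2 : (phi (f z) : C) @[n --> \oo] --> (phi z ^+ D * 1 : C).
  apply: cvg_trans (c1 _ _); apply: near_eq_cvg; have := asymp_neq0 as1.
  apply: filterS => n [_ n0] /=; rewrite /GRing.mul_fun /=.
  by rewrite mulrA feq // mulrAC divff // mul1r.
rewrite -[RHS]mulr1.
exact: (@cvg_unique _ (@norm_hausdorff _ C) _ _ _ _ (@cvg_cst C _ _ _ _) c2).
Unshelve. all: by end_near. Qed.

Lemma phi_iter_asymp z : V z ->
  asymp (fun n => phi (iter n f z)) (fun n => (iter n f z).2).
Proof.
move=> Vz; apply: phi_asymp => [n|M]; last exact: iter_unbounded.
exact: (@iter_Vplus 0).
Qed.

(** By the functional equation the values of [phi] agree along the whole orbits, and along each of
    them [phi] is asymptotic to the second coordinate. *)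
Lemma asymp_of_leaf z w : V z -> V w -> phi z = phi w ->
  asymp (fun n => (iter n f w).2) (fun n => (iter n f z).2).
Proof.
move=> Vz Vw zw.
have Vn n u : V u -> V (iter n f u) := @iter_Vplus 0 n u (leq0n n).
have phin n : phi (iter n f z) = phi (iter n f w).
  by elim: n => //= n IHn; rewrite !phi_comp ?IHn //; exact: Vn.
apply: asymp_trans (asymp_sym (phi_iter_asymp Vw)) _.
have -> : (fun n => phi (iter n f w)) = (fun n => phi (iter n f z)).
  by apply/funext => n; rewrite phin.
exact: phi_iter_asymp.
Qed.

Lemma global_leaf_superstable z : global_leaf f r phi z `<=` superstable f z.
Proof.
move=> w [Uw [N [Vz Vw phizw]]]; split => //; apply: cvg_lneNy => L L1.
have zw := asymp_of_leaf Vz Vw phizw.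
(* The orbits are compared from time N on. The rate L^2 makes up for this delay: L^(-2 (n - N)) <=
   L^-n once n >= 2 N. *)
have L2 : 1 <= L ^+ 2 by rewrite exprn_ege1.
have E u : (fun n => (orbs (n * m) u).2) = (fun n => (iter n f u).2).
  by apply/funext => n; rewrite (orb_iter p a m_gt0).
rewrite -!E in zw.
have [M _ MP] := orb_dist_superexp ds_ge2 ds_le ds_bound r_ge m_gt0
  ps_per as_per Vz Vw L2 zw.
exists (N + maxn M N)%N => // n /= Nn.
have nN : (N <= n)%N := leq_trans (leq_addr _ _) Nn.
have := MP (n - N)%N; rewrite /= !(orb_iter p a m_gt0) -!iterD subnK //.
rewrite -exprM => /(_ _)/le_trans; apply; first by lia.
by rewrite lef_pV2 ?posrE ?exprn_gt0 ?ler_weXn2l //; [lia|lra..].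
Qed.

Lemma superstable_global_leaf z : Uplus f z ->
  superstable f z `<=` global_leaf f r phi z.
Proof.
move=> Uz w [Uw /cvg_lneNy_le1[M _ MP]]; split => //.
have [N1 V1] := Uplus_Vplus Uz; have [N2 V2] := Uplus_Vplus Uw.
pose N := maxn M (maxn N1 N2).
have Vz : V (iter N f z) by apply: iter_Vplus V1; rewrite /N; lia.
have Vw : V (iter N f w) by apply: iter_Vplus V2; rewrite /N; lia.
have Vn n u : V u -> V (iter n f u) := @iter_Vplus 0 n u (leq0n n).
(* The second coordinates differ by at most 1 and tend to infinity; |y| >= 1 + 1/e gives 1 <= e |y|
   and y nonzero. *)
have wz : asymp (fun n => (iter n f (iter N f w)).2)
    (fun n => (iter n f (iter N f z)).2).
  apply/asympP => e e0; have := iter_unbounded (1 + e^-1) Vz.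
  apply: filterS => n h; have eV : 0 < e^-1 by rewrite invr_gt0.
  split; first by rewrite -cabs_gt0; lra.
  apply: (@le_trans _ _ 1); last first.
    by rewrite -ler_pdivrMl // mulr1; lra.
  rewrite -!iterD cabsC; have := MP (n + N)%N; rewrite /= => H.
  apply: le_trans (H _); last by rewrite /N; lia.
  exact: (proj2 (norm2_ge (_ - _))).
have t1 : asymp (fun n => phi (iter n f (iter N f w)))
    (fun n => phi (iter n f (iter N f z))).
  apply: asymp_trans (phi_iter_asymp Vw) _; apply: asymp_trans wz _.
  exact/asymp_sym/phi_iter_asymp.
(* Here t_n is the quotient of the values of [phi] along the two orbits, and the functional equation
   gives t_(n+1) = t_n^D. *)
have [n|n tn] := unity_expn_cvg degree_ge2 _ t1.
  by rewrite /= !phi_comp ?expr_div_n //; exact: Vn.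
exists (n + N)%N; rewrite !iterD; split; [exact: Vn|exact: Vn|].
(* A quotient with denominator 0 is 0 by convention, so t_n = 1 excludes it and the two values
   agree. *)
have [d0|d0] := eqVneq (phi (iter n f (iter N f z))) 0.
  by move: tn; rewrite d0 invr0 mulr0 => /esym/eqP; rewrite oner_eq0.
by rewrite -[RHS](divfK d0) tn mul1r.
Qed.

End Phi.

End Leaves.

Theorem propositionB1 (R : realType) (m : nat) (d : 'I_m -> nat)
    (p : 'I_m -> {poly R[i]}) (a : 'I_m -> R[i])
    (hm : (0 < m)%N)
    (hp : forall j : 'I_m, henon_poly (d j) (p j))
    (ha : forall j : 'I_m, a j != 0) :
  let f := henon_comp p a in
  exists r0 : R, forall r : R, r0 <= r ->
    forall phi : R[i] * R[i] -> R[i],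
      is_phi_plus f (\prod_(j < m) d j)%N r phi ->
      forall z : R[i] * R[i], Uplus f z ->
        global_leaf f r phi z = superstable f z.
Proof.
move=> f; have [K K0 boundK] := henon_bound_uniform a hp.
(* K bounds all factors at once, and from this radius on each factor maps V^+ into itself and at
   least doubles |y|. *)
exists (10 * K + 10) => r r_ge phi phiP z Uz.
have d_ge2 j : (2 <= d j)%N by have [] := hp j.
apply/seteqP; split.
  exact: (global_leaf_superstable hm d_ge2 boundK r_ge phiP).
exact: (superstable_global_leaf hm d_ge2 boundK r_ge phiP).
Qed.
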